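(* Let $I\subset\mathbb{R}$ be an open interval, $a,b\in I$ with $a<b$, and let $f:I\to\mathbb{R}$ be a twice differentiable mapping such that $f''$ is integrable on $[a,b]$. Let $0\le\lambda\le1$ and $q\ge1$. Suppose that $|f''|^q$ is convex on $[a,b]$. Then the following hold. If $0\le\lambda\le\frac12$, then $$\left|(\lambda-1)f\left(\frac{a+b}{2}\right)-\lambda\frac{f(a)+f(b)}{2}+\frac{1}{b-a}\int_a^b f(x)\,dx\right|$$ $$\le\frac{(b-a)^2}{2}\left(\frac{\lambda^3}{3}+\frac{1-3\lambda}{24}\right)^{1-\frac1q}\left\{\left(\left[\frac{\lambda^4}{6}+\frac{3-8\lambda}{3\cdot2^6}\right]|f''(a)|^q+\left[\frac{(2-\lambda)\lambda^3}{6}+\frac{5-16\lambda}{3\cdot2^6}\right]|f''(b)|^q\right)^{\frac1q}\right.$$ $$\left.+\left(\left[\frac{1+\lambda}{6}(1-\lambda)^3+\frac{48\lambda-27}{3\cdot2^6}\right]|f''(a)|^q+\left[\frac{\lambda^4}{6}+\frac{3-8\lambda}{3\cdot2^6}\right]|f''(b)|^q\right)^{\frac1q}\right\}.$$ If $\frac12\le\lambda\le1$, then $$\left|(\lambda-1)f\left(\frac{a+b}{2}\right)-\lambda\frac{f(a)+f(b)}{2}+\frac{1}{b-a}\int_a^b f(x)\,dx\right|$$ $$\le\frac{(b-a)^2}{2}\left(\frac{3\lambda-1}{24}\right)^{1-\frac1q}\left\{\left(\frac{8\lambda-3}{3\cdot2^6}|f''(a)|^q+\frac{16\lambda-5}{3\cdot2^6}|f''(b)|^q\right)^{\frac1q}+\left(\frac{16\lambda-5}{3\cdot2^6}|f''(a)|^q+\frac{8\lambda-3}{3\cdot2^6}|f''(b)|^q\right)^{\frac1q}\right\}.$$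 *)

(* Defs.v *)
From HB Require Import structures.
From mathcomp Require Export all_boot all_order all_algebra.
From mathcomp Require Export all_classical all_reals all_analysis.
Export Order.TTheory GRing.Theory Num.Theory numFieldNormedType.Exports.
#[export] Set Implicit Arguments.
#[export] Unset Strict Implicit.
#[export] Unset Printing Implicit Defensive.

Local Open Scope ring_scope.
Local Open Scope classical_set_scope.

(* A map on a subset of the line is represented by a total [f : R -> R]. On an
   open set [I] this is harmless: the values of [f^`()] and [f^`(2)] at points
   of [I] only depend on the restriction of [f] to [I]. *)
Definition twice_differentiable_on (R : realType) (I : set R) (f : R -> R) :=
  forall x, I x -> derivable f x 1 /\ derivable f^`() x 1.

(* Main.v *)
Require Import Defs.
From mathcomp Require Import ring lra.
Local Open Scope ring_scope.
Local Open Scope classical_set_scope.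

(** Write h = b - a, m = (a + b) / 2 and K(t) = t (t - lam), where lam stands for
    lambda.  The error functional is half the sum of two contributions, one for
    each half of [a, b].  On [m, b] put u(t) = f(t a + (1 - t) b), 0 <= t <= 1/2;
    the contribution is the increment of K u' - K' u + 2 U over [0, 1/2], where
    U' = u, and
      d/dt (K u' - K' u + 2 U) = K u''.
    The contribution of [a, m] comes from u(t) = f(t b + (1 - t) a), and the two
    terms in f'(m) cancel in the sum.  Let p and r be the values of |f''|^q at
    the endpoints whose coefficients in the argument of f are t and 1 - t.  By
    convexity |f''|^q <= p t + r (1 - t), and the power-mean inequality would
    bound each contribution by
      h^2 (int |K|)^(1 - 1/q) (int |K| (p t + r (1 - t)))^(1/q),
    all integrals being over [0, 1/2].

    The proof never integrates f''.  The tangent line of y |-> y^(1/q) at s^q,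
    taken at the chord p t + r (1 - t), dominates |f''| by an affine function of
    t ([weighted_amgm_tangent]), so
    the mean value inequality bounds the boundary terms by a primitive of |K|
    times that affine function, which is an explicit polynomial on each side of
    the sign change of K ([peano_kernel_half_bound]).  The resulting bound holds
    for every s > 0, and minimising over s produces the product of powers above
    ([le_powR_mean]).  The two cases of the theorem are the two positions of the
    zero lam of K with respect to 1/2. *)

(** * Boundary terms of the kernel and the mean value inequality *)

Lemma ler_norm_mean_value (R : realType) (G P G' P' : R -> R) (s e : R) :
  s <= e ->
  (forall x, s <= x <= e -> is_derive x 1 G (G' x)) ->
  (forall x, s <= x <= e -> is_derive x 1 P (P' x)) ->
  (forall x, s < x < e -> `|G' x| <= P' x) ->
  `|G e - G s| <= P e - P s.
Proof.
move=> se dG dP le_GP.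
suff mono (H H' : R -> R) : (forall x, s <= x <= e -> is_derive x 1 H (H' x)) ->
    (forall x, s < x < e -> H' x <= P' x) -> H e - P e <= H s - P s.
  have le_G := mono _ _ dG (fun x xse => le_trans (ler_norm _) (le_GP x xse)).
  have dNG x : s <= x <= e -> is_derive x 1 (- G) (- G' x).
    by move=> xse; apply: is_deriveN; exact: dG.
  have : - G e - P e <= - G s - P s.
    apply: (mono (- G) _ dNG) => x xse; apply: le_trans (le_GP x xse).
    by rewrite -normrN ler_norm.
  by move: le_G => *; rewrite ler_norml; apply/andP; split; lra.
move=> dH le_HP.
have dHP x : x \in `[s, e]%R -> is_derive x 1 (H - P) (H' x - P' x).
  by move=> xse; apply: is_deriveB; [exact: dH | exact: dP].
have inW x : x \in `]s, e[%R -> x \in `[s, e]%R.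
  by rewrite !in_itv /= => /andP[/ltW -> /ltW ->].
apply: (@ler0_derive1_le_cc _ (H - P) s e) => //.
- by move=> x /inW /dHP [].
- move=> x xse0; have /inW xse := xse0; have /dHP [_ dE] := xse.
  by rewrite derive1E dE subr_le0; apply: le_HP; rewrite in_itv in xse0.
- by apply: derivable_within_continuous => x /dHP [].
- by rewrite in_itv /= lexx se.
- by rewrite in_itv /= lexx se.
Qed.

(** Integration by parts in differential form: the kernel K(t) = t (t - lam) has
    K'' = 2, so all terms but K u'' cancel. *)
Lemma is_derive_kernel_by_parts (R : realType) (lam t : R)
    (U u u1 u2 : R -> R) :
  is_derive t 1 U (u t) -> is_derive t 1 u (u1 t) ->
  is_derive t 1 u1 (u2 t) ->
  is_derive t (1 : R)
    (fun x => x * (x - lam) * u1 x - (2 * x - lam) * u x + 2 * U x)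
    (t * (t - lam) * u2 t).
Proof.
move=> dU du du1; pose k : {poly R} := 'X * ('X - lam%:P).
have -> : (fun x => x * (x - lam) * u1 x - (2 * x - lam) * u x + 2 * U x)
    = horner k * u1 - horner k^`() * u + 2 *: U.
  apply/funext => x; rewrite !fctE /GRing.scale /= /k.
  by rewrite !(poly.derivE, hornerE) /=; ring.
apply: (is_derive_eq (is_deriveD (is_deriveB
  (is_deriveM (is_derive_poly k t) du1)
  (is_deriveM (is_derive_poly k^`() t) du)) (is_deriveZ 2 dU))).
by rewrite /GRing.scale /= /k !poly.derivE !hornerE /=; ring.
Qed.

(** The primitive vanishing at 0 of the signed kernel t (t - lam) times the
    affine function p t + r (1 - t). *)
Definition kernel_primitive (R : realType) (lam p r x : R) : R :=
  p * (x ^+ 4 / 4 - lam * x ^+ 3 / 3)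
  + r * (x ^+ 3 / 3 - lam * x ^+ 2 / 2 - (x ^+ 4 / 4 - lam * x ^+ 3 / 3)).

Lemma is_derive_kernel_primitive (R : realType) (lam p r t : R) :
  is_derive t (1 : R) (kernel_primitive lam p r)
    (t * (t - lam) * (p * t + r * (1 - t))).
Proof.
pose k : {poly R} := p *: (4^-1 *: 'X^4 - (lam / 3) *: 'X^3)
  + r *: (3^-1 *: 'X^3 - (lam / 2) *: 'X^2
          - (4^-1 *: 'X^4 - (lam / 3) *: 'X^3)).
have -> : kernel_primitive lam p r = horner k.
  by apply/funext => x; rewrite /kernel_primitive /k !hornerE /=; ring.
apply: (is_derive_eq (is_derive_poly k t)).
by rewrite /k !poly.derivE !hornerE /=; field.
Qed.

(** The integral over [0, 1/2] of |t (t - lam)| (p t + r (1 - t)) when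
    0 <= lam: the kernel is nonpositive before min(lam, 1/2) and nonnegative
    after it, whence the difference Q(1/2) - 2 Q(min(lam, 1/2)) for the
    primitive Q vanishing at 0. *)
Definition kernel_weight (R : realType) (lam p r : R) : R :=
  kernel_primitive lam p r (1 / 2)
  - 2 * kernel_primitive lam p r (Num.min lam (1 / 2)).

Lemma kernel_weight_le_half (R : realType) (lam p r : R) : lam <= 1 / 2 ->
  kernel_weight lam p r =
    (lam ^+ 4 / 6 + (3 - 8 * lam) / (3 * 2 ^+ 6)) * p
    + ((2 - lam) * lam ^+ 3 / 6 + (5 - 16 * lam) / (3 * 2 ^+ 6)) * r.
Proof.
by move=> /min_idPl lamE; rewrite /kernel_weight lamE /kernel_primitive; field.
Qed.

Lemma kernel_weight_ge_half (R : realType) (lam p r : R) : 1 / 2 <= lam ->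
  kernel_weight lam p r =
    (8 * lam - 3) / (3 * 2 ^+ 6) * p + (16 * lam - 5) / (3 * 2 ^+ 6) * r.
Proof.
by move=> /min_idPr lamE; rewrite /kernel_weight lamE /kernel_primitive; field.
Qed.

(** Both coefficients of the weight are bounded away from 0.  For lam <= 1/2 they
    are quartic polynomials in lam, and the proof exhibits squares centred near
    their minimisers. *)
Lemma kernel_weight_gt0 (R : realType) (lam p r : R) :
  0 <= lam -> 0 <= p -> 0 <= r -> 0 < p + r -> 0 < kernel_weight lam p r.
Proof.
move=> lam0 p0 r0 pr0.
suff [c [c1 [c2 [c0 cc1 cc2 ->]]]] : exists c c1 c2,
    [/\ 0 < c, c <= c1, c <= c2 & kernel_weight lam p r = c1 * p + c2 * r].
  apply: lt_le_trans (mulr_gt0 c0 pr0) _.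
  by rewrite mulrDr lerD // ler_wpM2r.
(* Any constant below the minima of the two coefficients would do here. *)
exists (1 / 384); have [le_half|/ltW ge_half] := leP lam (1 / 2).
  rewrite kernel_weight_le_half //.
  exists (lam ^+ 4 / 6 + (3 - 8 * lam) / (3 * 2 ^+ 6)).
  exists ((2 - lam) * lam ^+ 3 / 6 + (5 - 16 * lam) / (3 * 2 ^+ 6)).
  split; [by lra| | |reflexivity].
    (* The minimiser is 1 / 16^(1/3), close to 2/5. *)
    have : 0 <= (lam ^+ 2 - 4 / 25) ^+ 2 by exact: sqr_ge0.
    have : 0 <= (lam - 2 / 5) ^+ 2 by exact: sqr_ge0.
    by rewrite !exprS expr0; lra.
  (* Since 2 lam^3 - lam^4 >= 3/2 lam^3, it suffices to minimise
     48 lam^3 - 16 lam + 5, whose minimiser is 1/3. *)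
  have : 0 <= (lam - 1 / 3) ^+ 2 * (lam + 2 / 3).
    by rewrite mulr_ge0 ?sqr_ge0 //; lra.
  have : 0 <= lam ^+ 3 * (1 / 2 - lam) by rewrite mulr_ge0 ?exprn_ge0 //; lra.
  by rewrite !exprS expr0; lra.
rewrite kernel_weight_ge_half //.
exists ((8 * lam - 3) / (3 * 2 ^+ 6)), ((16 * lam - 5) / (3 * 2 ^+ 6)).
by split; [lra|lra|lra|reflexivity].
Qed.

(** The mean value inequality is applied separately on [0, m] and [m, 1/2], where
    m = min(lam, 1/2): on each piece the kernel has a constant sign, so that the
    primitive of its absolute value times the affine bound is polynomial. *)
Lemma peano_kernel_half_bound (R : realType) (lam p r : R)
    (U u u1 u2 : R -> R) :
  0 <= lam ->
  (forall t : R, 0 <= t <= 1 / 2 -> is_derive t 1 U (u t)) ->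
  (forall t : R, 0 <= t <= 1 / 2 -> is_derive t 1 u (u1 t)) ->
  (forall t : R, 0 <= t <= 1 / 2 -> is_derive t 1 u1 (u2 t)) ->
  (forall t : R, 0 <= t <= 1 / 2 -> `|u2 t| <= p * t + r * (1 - t)) ->
  `| (1 / 2 * (1 / 2 - lam) * u1 (1 / 2) - (1 - lam) * u (1 / 2)
      + 2 * U (1 / 2)) - (lam * u 0 + 2 * U 0) |
  <= kernel_weight lam p r.
Proof.
move=> lam_ge0 dU du du1 u2_le; rewrite /kernel_weight; set m := Num.min _ _.
have m_ge0 : 0 <= m by rewrite /m le_min lam_ge0 /=; lra.
have m_half : m <= 1 / 2 by rewrite /m ge_min lexx orbT.
have m_lam : m <= lam by rewrite /m ge_min lexx.
have lam_le (t : R) : m < t < 1 / 2 -> lam <= t.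
  by rewrite /m gt_min => /andP[/orP[/ltW //|]]; lra.
pose Q := kernel_primitive lam p r.
pose G t := t * (t - lam) * u1 t - (2 * t - lam) * u t + 2 * U t.
pose G' t := t * (t - lam) * u2 t.
have dG (t : R) : 0 <= t <= 1 / 2 -> is_derive t 1 G (G' t).
  by move=> t01; apply: is_derive_kernel_by_parts; [exact: dU|exact: du|
    exact: du1].
pose Q' x := x * (x - lam) * (p * x + r * (1 - x)).
have dQ (t : R) : is_derive t 1 Q (Q' t) by exact: is_derive_kernel_primitive.
have weight (x : R) : 0 <= x <= 1 / 2 ->
    `|G' x| <= `|x * (x - lam)| * (p * x + r * (1 - x)).
  by move=> x01; rewrite normrM ler_wpM2l // u2_le.
have le_right : `|G (1 / 2) - G m| <= Q (1 / 2) - Q m.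
  apply: (@ler_norm_mean_value _ _ _ G' Q') => //= x /andP[mx x1].
    by apply: dG; rewrite (le_trans m_ge0).
  apply: le_trans (weight x _) _; first by rewrite !ltW // (le_lt_trans m_ge0).
  rewrite ger0_norm // mulr_ge0 //; first by rewrite (le_trans m_ge0) // ltW.
  by rewrite subr_ge0 lam_le // mx.
have le_left : `|G m - G 0| <= - Q m - - Q 0.
  apply: (@ler_norm_mean_value _ _ (- Q) G' (- Q')) => //= x /andP[x0 xm].
  - by apply: dG; rewrite x0 (le_trans xm).
  - apply: le_trans (weight x _) _; first by rewrite !ltW // (lt_le_trans xm).
    rewrite ler0_norm ?mulNr // mulr_ge0_le0 ?ltW //.
    by rewrite subr_lt0 (lt_le_trans xm).
have Q0 : Q 0 = 0 by rewrite /Q /kernel_primitive; field.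
have -> : (1 / 2 * (1 / 2 - lam) * u1 (1 / 2) - (1 - lam) * u (1 / 2)
    + 2 * U (1 / 2)) - (lam * u 0 + 2 * U 0) = (G (1 / 2) - G m) + (G m - G 0).
  by rewrite /G; field.
apply: le_trans (ler_normD _ _) _; rewrite -!/(Q _); lra.
Qed.

(** * Power means without integrals *)

(** The concave function x |-> x^(1/q) lies below its tangent at c^q; the
    inequality is that fact at x = y^q, and follows from the concavity of ln
    applied to (y / c)^q and 1. *)
Lemma weighted_amgm_tangent (R : realType) (q y c : R) :
  1 <= q -> 0 <= y -> 0 < c ->
  y <= c / (q * c `^ q) * y `^ q + (1 - 1 / q) * c.
Proof.
move=> q1 y0 c0; have q0 : 0 < q by exact: lt_le_trans q1.
have qne0 : q != 0 by rewrite gt_eqF.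
have cq0 : 0 < c `^ q by exact: powR_gt0.
have [->|yn0] := eqVneq y 0.
  rewrite powR0 // mulr0 add0r mulr_ge0 ?(ltW c0) // subr_ge0.
  by rewrite ler_pdivrMr ?mul1r.
have ygt0 : 0 < y by rewrite lt_def yn0.
pose z := y / c; have z0 : 0 < z by rewrite divr_gt0.
have q01 : q^-1 <= 1 by rewrite invf_le1.
have := @concave_ln _ (Itv01 (eqbRL (invr_ge0 _) (ltW q0)) q01) _ _
  (powR_gt0 q z0) (@ltr01 R).
rewrite !convRE /= /unstable.onem ln1 mulr0 addr0 mulr1 ln_powR mulKf //.
rewrite ler_ln ?posrE //; last first.
  by rewrite ltr_wpDr ?subr_ge0 // mulr_gt0 ?invr_gt0 // powR_gt0.
have -> : y = z * c by rewrite /z mulfVK // gt_eqF.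
rewrite powRM ?(ltW z0) ?(ltW c0) // => le_z.
have -> : c / (q * c `^ q) * (z `^ q * c `^ q) + (1 - 1 / q) * c
    = (q^-1 * z `^ q + (1 - q^-1)) * c.
  by field; rewrite !gt_eqF.
by rewrite (ler_wpM2r (ltW c0)).
Qed.

(** Optimisation of the tangent bound.  The best point satisfies c^q = J / C; when
    J = 0 the infimum is only approached as c tends to 0. *)
Lemma le_powR_mean (R : realType) (q C J X : R) : 1 <= q -> 0 < C -> 0 <= J ->
  (forall c, 0 < c -> X <= c / (q * c `^ q) * J + (1 - 1 / q) * c * C) ->
  X <= C `^ (1 - 1 / q) * J `^ (1 / q).
Proof.
move=> q1 C0 J0 le_X; have q0 : 0 < q by exact: lt_le_trans q1.
have qne0 : q != 0 by rewrite gt_eqF.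
have [JE|Jne0] := eqVneq J 0.
  rewrite JE powR0 ?mulr0; last by rewrite div1r invr_eq0.
  apply/ler_addgt0Pl => e e0; rewrite addr0.
  have := le_X (e / C) (divr_gt0 e0 C0); rewrite JE mulr0 add0r.
  move=> /le_trans; apply.
  by rewrite -mulrA mulfVK ?gt_eqF // ler_piMl ?(ltW e0) // gerBl divr_ge0 // ltW.
have Jgt0 : 0 < J by rewrite lt_def Jne0.
pose c := (J / C) `^ (1 / q).
have c0 : 0 < c by rewrite powR_gt0 // divr_gt0.
have cq : c `^ q = J / C.
  by rewrite -powRrM div1r mulVf // powRr1 // ltW // divr_gt0.
have -> : C `^ (1 - 1 / q) * J `^ (1 / q) = c * C.
  rewrite /c powRM ?invr_ge0 ?(ltW Jgt0) ?(ltW C0) // -(powR_inv1 (ltW C0)) -powRrM.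
  rewrite powRB; last by rewrite (gt_eqF C0) implybT.
  by rewrite (powRr1 (ltW C0)) mulN1r powRN; ring.
apply: le_trans (le_X _ c0) _; rewrite cq le_eqVlt; apply/orP; left; apply/eqP.
by field; rewrite !gt_eqF.
Qed.

(** * Assembling the two halves *)

(** The primitive is based at a point of I to the left of a, so that it is
    differentiable on the whole closed segment, endpoints included. *)
Lemma antiderivative_itv (R : realType) (I : set R) (f : R -> R) (a b : R) :
  open I -> is_interval I -> I a -> I b -> a < b ->
  (forall x, I x -> derivable f x 1) ->
  exists2 F : R -> R,
    forall x : R, a <= x <= b -> is_derive x 1 F (f x) &
    \int[lebesgue_measure]_(x in `[a, b]) f x = F b - F a.
Proof.
move=> oI iI Ia Ib ab df.
have [a0 a0a Ia0] : exists2 a0, a0 < a & I a0.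
  have /filter_ex[a0 []] : \forall x \near a^'-, x < a /\ I x; last by exists a0.
  apply: filterI; first exact: nbhs_left_lt.
  by apply: cvg_within; apply: open_nbhs_nbhs.
have [b0 bb0 Ib0] : exists2 b0, b < b0 & I b0.
  have /filter_ex[b0 []] : \forall x \near b^'+, b < x /\ I x; last by exists b0.
  apply: filterI; first exact: nbhs_right_gt.
  by apply: cvg_within; apply: open_nbhs_nbhs.
have cf x : I x -> {for x, continuous f}.
  by move=> Ix; apply: differentiable_continuous; apply/derivable1_diffP; apply: df.
have I0 x : a0 <= x <= b0 -> I x by move=> xab; apply: iI xab.
have intf : lebesgue_measure.-integrable `[a0, b0] (EFin \o f).
  apply: continuous_compact_integrable; first exact: segment_compact.
  apply: derivable_within_continuous => x; rewrite in_itv /= => /I0; exact: df.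
pose F x := (\int[lebesgue_measure]_(t in `[a0, x]) f t).
have dF x : a <= x <= b -> derivable F x 1 /\ F^`() x = f x.
  move=> /andP[ax xb]; apply: (@continuous_FTC1 _ f (BLeft a0) x b0 _ intf).
  - exact: le_lt_trans bb0.
  - by rewrite lte_fin (lt_le_trans a0a).
  - apply: cf; apply: I0; rewrite !ltW ?(le_lt_trans xb) ?(lt_le_trans a0a) //.
have dF' x : a <= x <= b -> is_derive x 1 F (f x).
  by move=> /dF [dFx <-]; rewrite derive1E; apply: derivableP.
exists F => //.
rewrite /Rintegral (@continuous_FTC2 _ f F a b) //.
- apply: derivable_within_continuous => x.
  rewrite in_itv /= => /andP[ax xb]; apply: df.
  by apply: (iI a b) => //; rewrite ax.
- have cF x : a <= x <= b -> {for x, continuous F}.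
    by move=> /dF [? _]; apply: differentiable_continuous; apply/derivable1_diffP.
  split.
  + by move=> x; rewrite in_itv /= => /andP[/ltW ax /ltW xb]; apply: (dF x _).1; rewrite ax.
  + by apply: cvg_at_right_filter; apply: cF; rewrite lexx ltW.
  + by apply: cvg_at_left_filter; apply: cF; rewrite lexx ltW.
- by move=> x; rewrite in_itv /= => /andP[/ltW ax /ltW xb]; apply: (dF x _).2; rewrite ax.
Qed.

(** One half of the estimate, along the line t |-> c + t d.  It is used with
    c = b, d = a - b for [(a + b) / 2, b] and with c = a, d = b - a for
    [a, (a + b) / 2]; for both, t = 1/2 is the midpoint. *)
Lemma half_interval_bound (R : realType) (lam q p r c d : R) (F f : R -> R) :
  0 <= lam -> 1 <= q -> 0 <= p -> 0 <= r -> d != 0 ->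
  (forall t : R, 0 <= t <= 1 / 2 ->
    [/\ is_derive (c + t * d) 1 F (f (c + t * d)), derivable f (c + t * d) 1,
        derivable f^`() (c + t * d) 1
      & `|f^`(2) (c + t * d)| `^ q <= p * t + r * (1 - t)]) ->
  `| (1 / 2 * (1 / 2 - lam) * (d * f^`()%classic (c + 1 / 2 * d))
       - (1 - lam) * f (c + 1 / 2 * d) + 2 * (F (c + 1 / 2 * d) / d))
     - (lam * f c + 2 * (F c / d)) |
  <= d ^+ 2 * (kernel_weight lam 1 1 `^ (1 - 1 / q)
               * kernel_weight lam p r `^ (1 / q)).
Proof.
move=> lam0 q1 p0 r0 d0 Hf.
have d2 : 0 < d ^+ 2 by rewrite exprn_even_gt0.
rewrite -ler_pdivrMl // mulrC.
have dline (t : R) : is_derive t (1 : R) (fun x => c + x * d) d.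
  pose k : {poly R} := c%:P + d *: 'X.
  have -> : (fun x => c + x * d) = horner k.
    by apply/funext => x; rewrite /k !hornerE mulrC.
  by apply: (is_derive_eq (is_derive_poly k t)); rewrite /k !poly.derivE !hornerE.
pose U t := d^-1 * F (c + t * d).
pose u t := f (c + t * d).
pose u1 t := d * f^`()%classic (c + t * d).
pose u2 t := d * (d * f^`(2)%classic (c + t * d)).
have dU (t : R) : 0 <= t <= 1 / 2 -> is_derive t 1 U (u t).
  move=> /Hf[dF _ _ _].
  refine (is_derive_eq (is_deriveZ d^-1
    (is_derive1_comp (g := fun x => c + x * d) dF (dline t))) _).
  by rewrite /GRing.scale /= mulrC mulfK.
have du (t : R) : 0 <= t <= 1 / 2 -> is_derive t 1 u (u1 t).
  move=> /Hf[_ /derivableP df _ _].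
  refine (is_derive_eq (is_derive1_comp (g := fun x => c + x * d) df (dline t)) _).
  by rewrite /u1 derive1E mulrC.
have du1 (t : R) : 0 <= t <= 1 / 2 -> is_derive t 1 u1 (u2 t).
  move=> /Hf[_ _ /derivableP df1 _].
  refine (is_derive_eq (is_deriveZ d
    (is_derive1_comp (g := fun x => c + x * d) df1 (dline t))) _).
  by rewrite /u2 /GRing.scale /= -derive1E [_ * d]mulrC.
apply: le_powR_mean => // [||s s0].
- by apply: kernel_weight_gt0 => //; lra.
- have [pr0|] := ltP 0 (p + r); first exact/ltW/kernel_weight_gt0.
  move=> pr_le0; have -> : p = 0 by lra.
  have -> : r = 0 by lra.
  by rewrite /kernel_weight /kernel_primitive !mul0r addr0 mulr0 subrr.
set k1 := s / _; set k2 := (1 - 1 / q) * s.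
have k10 : 0 <= k1.
  rewrite divr_ge0 ?(ltW s0) // mulr_ge0 ?powR_ge0 //; lra.
have u2_le (t : R) : 0 <= t <= 1 / 2 ->
    `|u2 t| <= (d ^+ 2 * (k1 * p + k2)) * t
              + (d ^+ 2 * (k1 * r + k2)) * (1 - t).
  move=> t01; have [_ _ _ le_pr] := Hf _ t01.
  have -> : (d ^+ 2 * (k1 * p + k2)) * t + (d ^+ 2 * (k1 * r + k2)) * (1 - t)
    = d ^+ 2 * (k1 * (p * t + r * (1 - t)) + k2) by ring.
  rewrite /u2 mulrA normrM -expr2 ger0_norm ?(ltW d2) // ler_pM2l //.
  apply: le_trans (weighted_amgm_tangent q1 (normr_ge0 _) s0) _.
  by rewrite lerD2r ler_wpM2l.
have := peano_kernel_half_bound lam0 dU du du1 u2_le.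
have -> : kernel_weight lam (d ^+ 2 * (k1 * p + k2)) (d ^+ 2 * (k1 * r + k2))
   = d ^+ 2 * (k1 * kernel_weight lam p r + k2 * kernel_weight lam 1 1).
  by rewrite /kernel_weight /kernel_primitive; ring.
rewrite /U /u /u1 mul0r addr0 !(mulrC d^-1) => le_X.
by rewrite ler_pdivrMr // [leRHS]mulrC.
Qed.

Theorem theorem5 (R : realType) (I : set R) (a b : R) (f : R -> R)
    (lambda q : R) :
  open I -> is_interval I -> I a -> I b -> a < b ->
  twice_differentiable_on I f ->
  lebesgue_measure.-integrable `[a, b] (EFin \o f^`(2)) ->
  0 <= lambda <= 1 -> 1 <= q ->
  convex_function (`[a, b]%classic : set R^o)
    (fun x : R => `|f^`(2) x| `^ q) ->
  (0 <= lambda <= 1 / 2 ->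
    `| (lambda - 1) * f ((a + b) / 2) - lambda * ((f a + f b) / 2)
       + 1 / (b - a) * \int[lebesgue_measure]_(x in `[a, b]) f x |
    <= (b - a) ^+ 2 / 2
       * (lambda ^+ 3 / 3 + (1 - 3 * lambda) / 24) `^ (1 - 1 / q)
       * ( ( (lambda ^+ 4 / 6 + (3 - 8 * lambda) / (3 * 2 ^+ 6))
               * `|f^`(2) a| `^ q
           + ((2 - lambda) * lambda ^+ 3 / 6
                + (5 - 16 * lambda) / (3 * 2 ^+ 6))
               * `|f^`(2) b| `^ q ) `^ (1 / q)
         + ( ((1 + lambda) / 6 * (1 - lambda) ^+ 3
                + (48 * lambda - 27) / (3 * 2 ^+ 6))
               * `|f^`(2) a| `^ q
           + (lambda ^+ 4 / 6 + (3 - 8 * lambda) / (3 * 2 ^+ 6))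
               * `|f^`(2) b| `^ q ) `^ (1 / q) ))
  /\
  (1 / 2 <= lambda <= 1 ->
    `| (lambda - 1) * f ((a + b) / 2) - lambda * ((f a + f b) / 2)
       + 1 / (b - a) * \int[lebesgue_measure]_(x in `[a, b]) f x |
    <= (b - a) ^+ 2 / 2
       * ((3 * lambda - 1) / 24) `^ (1 - 1 / q)
       * ( ( (8 * lambda - 3) / (3 * 2 ^+ 6) * `|f^`(2) a| `^ q
           + (16 * lambda - 5) / (3 * 2 ^+ 6) * `|f^`(2) b| `^ q ) `^ (1 / q)
         + ( (16 * lambda - 5) / (3 * 2 ^+ 6) * `|f^`(2) a| `^ q
           + (8 * lambda - 3) / (3 * 2 ^+ 6) * `|f^`(2) b| `^ q ) `^ (1 / q) )).
Proof.
move=> oI iI Ia Ib ab df _ /andP[lam0 lam1] q1 cvx.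
have Iab x : a <= x <= b -> I x by exact: iI.
have [F dF ->] := antiderivative_itv oI iI Ia Ib ab (fun x Ix => (df x Ix).1).
have chord (t : R) : 0 <= t <= 1 -> `|f^`(2) (t * a + (1 - t) * b)| `^ q
    <= t * `|f^`(2) a| `^ q + (1 - t) * `|f^`(2) b| `^ q.
  move=> /andP[t0 t1]; have := cvx (Itv01 t0 t1) a b.
  by rewrite !inE /= !in_itv /= !lexx !(ltW ab) => /(_ isT isT).
move: (powR_ge0 `|f^`(2) a| q) (powR_ge0 `|f^`(2) b| q) chord.
(* The endpoint values enter only through their signs and the chord bound. *)
generalize (`|f^`(2) a| `^ q) => A; generalize (`|f^`(2) b| `^ q) => B.
move=> A0 B0 chord.
have Ic (t : R) : 0 <= t <= 1 -> a <= t * a + (1 - t) * b <= b.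
  by move=> /andP[t0 t1]; apply/andP; split; nra.
have h0 : b - a != 0 by rewrite subr_eq0 gt_eqF.
have from_b : forall t : R, 0 <= t <= 1 / 2 ->
    [/\ is_derive (b + t * - (b - a)) 1 F (f (b + t * - (b - a))),
        derivable f (b + t * - (b - a)) 1,
        derivable f^`() (b + t * - (b - a)) 1
      & `|f^`(2) (b + t * - (b - a))| `^ q <= A * t + B * (1 - t)].
  move=> t /andP[t0 t1]; have t01 : 0 <= t <= 1 by rewrite t0; lra.
  have -> : b + t * - (b - a) = t * a + (1 - t) * b by ring.
  have [df0 df1] := df _ (Iab _ (Ic _ t01)).
  split; [exact/dF/Ic|exact: df0|exact: df1|].
  by rewrite [A * t]mulrC [B * _]mulrC; exact: chord.
have from_a : forall t : R, 0 <= t <= 1 / 2 ->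
    [/\ is_derive (a + t * (b - a)) 1 F (f (a + t * (b - a))),
        derivable f (a + t * (b - a)) 1,
        derivable f^`() (a + t * (b - a)) 1
      & `|f^`(2) (a + t * (b - a))| `^ q <= B * t + A * (1 - t)].
  move=> t /andP[t0 t1]; have t01 : 0 <= 1 - t <= 1 by apply/andP; split; lra.
  have -> : a + t * (b - a) = (1 - t) * a + (1 - (1 - t)) * b by ring.
  have [df0 df1] := df _ (Iab _ (Ic _ t01)).
  split; [exact/dF/Ic|exact: df0|exact: df1|].
  apply: le_trans (chord _ t01) _; lra.
have := half_interval_bound lam0 q1 A0 B0 _ from_b.
rewrite oppr_eq0 => /(_ h0).
have := half_interval_bound lam0 q1 B0 A0 h0 from_a.
rewrite sqrrN.
have -> : b + 1 / 2 * - (b - a) = (a + b) / 2 by field.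
have -> : a + 1 / 2 * (b - a) = (a + b) / 2 by field.
set X2 := (X in `|X| <= _ -> _); set X1 := (X in _ -> `|X| <= _ -> _).
move=> le2 le1.
(* The midpoint slopes enter X1 and X2 with opposite signs and cancel. *)
have lhsE : (lambda - 1) * f ((a + b) / 2) - lambda * ((f a + f b) / 2)
    + 1 / (b - a) * (F b - F a) = (X1 + X2) / 2.
  by rewrite /X1 /X2; field.
have main : `|(lambda - 1) * f ((a + b) / 2) - lambda * ((f a + f b) / 2)
    + 1 / (b - a) * (F b - F a)| <= (b - a) ^+ 2 / 2
      * kernel_weight lambda 1 1 `^ (1 - 1 / q)
      * (kernel_weight lambda A B `^ (1 / q)
         + kernel_weight lambda B A `^ (1 / q)).
  rewrite lhsE normrM [`|2^-1|]ger0_norm ?invr_ge0 //.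
  have := ler_normD X1 X2; lra.
split => [/andP[_ lam_half]|/andP[lam_half _]]; apply: le_trans main _;
  rewrite le_eqVlt; apply/orP; left; apply/eqP.
- rewrite !kernel_weight_le_half //.
  by congr (_ * _ `^ _ * (_ `^ _ + _ `^ _)); field.
- rewrite !kernel_weight_ge_half //.
  by congr (_ * _ `^ _ * (_ `^ _ + _ `^ _)); field.
Qed.
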